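(* Let $V=\{1,\dots,n\}$ with $n\ge1$, let $f:2^V\to\mathbb{R}_+$ be a non-decreasing submodular function with $f(\emptyset)=0$, and let $w\in\mathbb{R}^n$ have all $w_i>0$. If the payoff $P_{f,w}$ is decreasing, then $f(S)/w^{-1}(S)$ is non-increasing in $S$ (with respect to inclusion of non-empty sets $S\subseteq V$), and the value of the game $\Gamma_{\max}(\mathcal{B}(f),w)$ is $f(V)/w^{-1}(V)$. Moreover, the strategy $x^{\mathcal{S}}$ is optimal for Player 1, where $\mathcal{S}$ consists only of the set $V$, that is, $x^{\mathcal{S}}_i=w_i^{-1}f(V)/w^{-1}(V)$ for all $i\in V$; and $y^V$ is optimal for Player 2.
   Context: For $x\in\mathbb{R}^n$ and $S\subseteq V$, write $x(S)=\sum_{j\in S}x_j$. The base polyhedron is $\mathcal{B}(f)=\{x\in\mathbb{R}^n_+: x(S)\le f(S)\text{ for all }S\subseteq V,\ x(V)=f(V)\}$. Its vertices are the points $x^\sigma$, for permutations $\sigma$ of $V$, given by $x^\sigma_{\sigma(j)}=f(\{\sigma(1),\dots,\sigma(j)\})-f(\{\sigma(1),\dots,\sigma(j-1)\})$, $j=1,\dots,n$. The zero-sum game $\Gamma_{\max}(\mathcal{B}(f),w)$: a pure strategy of Player 1 (the maximizer) is a permutation $\sigma$ of $V$ (equivalently a vertex $x^\sigma$), a pure strategy of Player 2 (the minimizer) is $j\in V$, and the payoff is $P_{f,w}(\sigma,j)=w_jx^\sigma_j$. A mixed strategy of Player 1 is identified with a point $x\in\mathcal{B}(f)$. A mixed strategy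 of Player 2 is identified with a point of the simplex $C=\{\sum_{j=1}^n\theta_jw_je^j:\theta_j\ge0,\ \sum_j\theta_j=1\}$, where $e^j$ is the $j$th coordinate vector. The expected payoff is $x^Ty$. The value is $v=\max_{x\in\mathcal{B}(f)}\min_{j}w_jx_j=\min_{y\in C}\max_{\sigma}(x^\sigma)^Ty$. A Player 1 strategy $x$ is optimal if $\min_jw_jx_j=v$, and a Player 2 strategy $y$ is optimal if $\max_{x\in\mathcal{B}(f)}x^Ty=v$. For $S\subseteq V$, $w^{-1}(S)=\sum_{i\in S}1/w_i$; $y^V=\frac{1}{w^{-1}(V)}\sum_{i\in V}e^i$. The payoff $P_{f,w}$ is decreasing if for every permutation $\sigma$ of $V$ and all $i,j\in V$ with $\sigma^{-1}(i)<\sigma^{-1}(j)$ (i.e. $i$ precedes $j$ in $\sigma$), $P_{f,w}(\sigma,i)\ge P_{f,w}(\sigma,j)$. *)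

(* Defs.v *)
(* Subsets of V are finite sets ([%SET]); sets of reals or of vectors are
   classical sets ([%classic]). *)
From HB Require Import structures.
From mathcomp Require Import all_boot all_order all_fingroup all_algebra.
From mathcomp Require Import classical_sets reals.

Set Implicit Arguments.
Unset Strict Implicit.
Unset Printing Implicit Defensive.
Import Order.TTheory GRing.Theory Num.Theory.
Local Open Scope ring_scope.

(* The ground set V is 'I_n, and vectors of R^n are row vectors. *)

Section Game.
Variables (R : realType) (n : nat).
Implicit Types (f : {set 'I_n} -> R) (w x y : 'rV[R]_n) (S : {set 'I_n}).
Implicit Types (s : 'S_n) (A : set R).

Definition nondecreasing_setfun f : Prop :=
  forall S T : {set 'I_n}, S \subset T -> f S <= f T.

Definition submodular f : Prop :=
  forall S T : {set 'I_n}, f (S :|: T) + f (S :&: T) <= f S + f T.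

Definition vsum x S : R := \sum_(j in S) x 0 j.

Definition winv w S : R := \sum_(i in S) (w 0 i)^-1.

Definition dotp x y : R := \sum_j x 0 j * y 0 j.

Definition base_polyhedron f : set 'rV[R]_n :=
  [set x : 'rV[R]_n | [/\ forall j, 0 <= x 0 j,
               forall S : {set 'I_n}, vsum x S <= f S &
               vsum x [set: 'I_n]%SET = f [set: 'I_n]%SET]]%classic.

(* [s k] is the element in position [k], so the position of [i] is [s^-1 i];
   see [vertexE]. *)
Definition vertex f s : 'rV[R]_n :=
  \row_i (f [set s k | k : 'I_n & (k <= s^-1%g i)%N]%SET
          - f [set s k | k : 'I_n & (k < s^-1%g i)%N]%SET).

Lemma vertexE f s j :
  vertex f s 0 (s j) = f [set s k | k : 'I_n & (k <= j)%N]%SET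
                       - f [set s k | k : 'I_n & (k < j)%N]%SET.
Proof. by rewrite mxE permK. Qed.

Definition payoff f w s (j : 'I_n) : R := w 0 j * vertex f s 0 j.

Definition decreasing_payoff f w : Prop :=
  forall s (i j : 'I_n), (s^-1%g i < s^-1%g j)%N ->
    payoff f w s j <= payoff f w s i.

(* Mixed strategies of the minimizer, already scaled by [w]: if Player 2 plays
   [j] with probability [theta 0 j], the expected payoff against [x] is
   [dotp x y].  Mixed strategies of Player 1 are the points of
   [base_polyhedron f]. *)
Definition mixed2 w : set 'rV[R]_n :=
  [set y : 'rV[R]_n | exists theta : 'rV[R]_n,
     [/\ forall j, 0 <= theta 0 j,
         \sum_j theta 0 j = 1 &
         y = \sum_j (theta 0 j * w 0 j) *: delta_mx 0 j]]%classic.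

(* Attained maximum and minimum. *)
Definition is_max A (m : R) : Prop := A m /\ ubound A m.
Definition is_min A (m : R) : Prop := A m /\ lbound A m.

(* [guarantee1 w x m] reads: m = min_j w_j x_j. *)
Definition guarantee1 w x : R -> Prop :=
  is_min (range (fun j => w 0 j * x 0 j)).

(* v = max_{x in B(f)} min_j w_j x_j = min_{y in C} max_s (x^s)^T y. *)
Definition game_value f w (v : R) : Prop :=
  is_max [set m | exists2 x, base_polyhedron f x & guarantee1 w x m]%classic v
  /\
  is_min [set m | exists2 y, mixed2 w y &
            is_max (range (fun s => dotp (vertex f s) y)) m]%classic v.

Definition optimal1 f w x : Prop :=
  base_polyhedron f x /\ exists2 v, game_value f w v & guarantee1 w x v.

Definition optimal2 f w y : Prop :=
  mixed2 w y /\
  exists2 v, game_value f w v &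
    is_max [set dotp x y | x in base_polyhedron f]%classic v.

Definition yV w : 'rV[R]_n :=
  (winv w [set: 'I_n]%SET)^-1 *: \sum_i delta_mx 0 i.

End Game.

(* Main.v *)
Require Import Defs.
From mathcomp Require Import all_boot all_order all_fingroup all_algebra.
From mathcomp Require Import classical_sets reals.

(** Write [v = f(V) / winv(V)] and let [x*] be the vector with [w_i x*_i = v]
    for all [i].

    Monotonicity of the ratio.  Given [S] included in [T], list the elements of
    [S], then those of [T \ S], then the others.  For the corresponding vertex
    [x], the sums [x(S)] and [x(T)] telescope to [f S] and [f T], and the
    decreasing payoff gives [w_j x_j <= w_i x_i] for [i] in [S] and [j] in
    [T \ S].  Dividing by [w_i w_j] and summing over all such pairs yields
    [winv(S) (f T - f S) <= (winv(T) - winv(S)) f S], which is the claim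
    ([ratio_nonincreasing]).

    Value.  Comparing each [S] with [V], monotonicity says exactly that
    [x*(S) <= f S], so [x*] lies in the base polyhedron ([equalizer_in_base])
    and guarantees [v].  No [x] in the polyhedron guarantees more: if
    [m <= w_j x_j] for all [j], then summing [m / w_j <= x_j] gives
    [m winv(V) <= f V].  For Player 2, the strategy [y^V] is an equalizer: its
    payoff against [x] is [x(V) / winv(V)], which is [v] on every vertex and on
    the whole base polyhedron.  Finally any [y] of Player 2 concedes [v] against
    [x*], hence concedes at least [v] against some vertex, by the greedy
    algorithm for linear maximization over a polymatroid ([greedy]); this
    replaces the description of the base polyhedron as the convex hull of the
    points [vertex f s]. *)

Set Implicit Arguments.
Unset Strict Implicit.
Unset Printing Implicit Defensive.
Import Order.TTheory GRing.Theory Num.Theory.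
Local Open Scope ring_scope.

(** * Vertices and linear maximization *)

Section Vertices.
Variables (R : realType) (n : nat).
Implicit Types (f : {set 'I_n} -> R) (w x y : 'rV[R]_n) (S : {set 'I_n}).
Implicit Types (s : 'S_n).

Definition prefix s (m : nat) : {set 'I_n} :=
  [set i | (s^-1%g i < m)%N]%SET.

Lemma imset_prefix s m :
  [set s k | k : 'I_n & (k < m)%N]%SET = prefix s m.
Proof.
apply/setP => i; rewrite inE; apply/imsetP/idP.
  by case=> k; rewrite inE => ltkm ->; rewrite permK.
by move=> lt_im; exists (s^-1%g i); rewrite ?inE ?permKV.
Qed.

Lemma vertex_prefix f s i :
  vertex f s 0 i = f (prefix s (s^-1%g i).+1) - f (prefix s (s^-1%g i)).
Proof. by rewrite mxE -!imset_prefix. Qed.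

Lemma prefix0 s : prefix s 0 = finset.set0.
Proof. by apply/setP => i; rewrite !inE. Qed.

Lemma prefix_size s : prefix s n = [set: 'I_n]%SET.
Proof. by apply/setP => i; rewrite !inE ltn_ord. Qed.

Lemma sum_prefixS s (k : 'I_n) (F : 'I_n -> R) :
  \sum_(i in prefix s k.+1) F i = \sum_(i in prefix s k) F i + F (s k).
Proof.
rewrite (bigD1 (s k)) /=; last by rewrite inE permK.
rewrite addrC; congr (_ + _); apply: eq_bigl => i.
rewrite !inE ltnS [RHS]ltn_neqAle andbC; congr (~~ _ && _).
by rewrite -[RHS](inj_eq (@perm_inj _ s)) permKV.
Qed.

Lemma vsum_vertex_prefix f s m : f finset.set0 = 0 -> (m <= n)%N ->
  vsum (vertex f s) (prefix s m) = f (prefix s m).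
Proof.
move=> f0; elim: m => [_|m IHm lt_mn]; first by rewrite prefix0 f0 /vsum big_set0.
have := sum_prefixS s (Ordinal lt_mn) (vertex f s 0); rewrite /= -!/(vsum _ _).
by move=> ->; rewrite IHm ?(ltnW lt_mn)// vertex_prefix permK /= addrC subrK.
Qed.

(** The marginal gains telescope along an initial segment of the order.  Being
    closed under predecessors is the form in which segments arise from sorting,
    and it spares their cardinality. *)
Lemma vsum_vertex f s S : f finset.set0 = 0 ->
    (forall i j, i \in S -> (s^-1%g j <= s^-1%g i)%N -> j \in S) ->
  vsum (vertex f s) S = f S.
Proof.
move=> f0 S_init; set m := \max_(i in S) (s^-1%g i).+1.
have -> : S = prefix s m.
  apply/setP => i; rewrite inE; apply/idP/idP => [iS|].
    exact: (@leq_bigmax_cond _ (mem S) (fun i => (s^-1%g i).+1) i iS).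
  apply: contraLR => iS; rewrite -leqNgt; apply/bigmax_leqP => j jS.
  by rewrite ltnNge; apply: contra iS; exact: S_init.
by apply: vsum_vertex_prefix => //; apply/bigmax_leqP => i _; exact: ltn_ord.
Qed.

Lemma exists_decreasing_order (g : 'I_n -> R) :
  exists s : 'S_n, forall i j, (s^-1%g i <= s^-1%g j)%N -> g j <= g i.
Proof.
pose r : rel 'I_n := fun i j => g j <= g i.
have r_total : total r by move=> i j; exact: le_total.
have r_trans : transitive r by move=> j i k ij jk; exact: le_trans jk ij.
have /tuple_permP[s es] : perm_eq (sort_tuple r (ord_tuple n)) (ord_tuple n).
  by rewrite /= perm_sort.
exists s => i j le_ij.
have srt : sorted r (sort_tuple r (ord_tuple n)) by exact: sort_sorted.
have nthE k : nth i (sort_tuple r (ord_tuple n)) (s^-1%g k) = k.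
  by rewrite es nth_mktuple tnth_ord_tuple permKV.
have := sorted_leq_nth r_trans (fun i => lexx (g i)) i srt.
move=> /(_ (s^-1%g i) (s^-1%g j)).
by rewrite !inE size_tuple !ltn_ord !nthE; apply.
Qed.

(** The optimality of the greedy algorithm: visiting the coordinates in
    decreasing order of [y] is at least as good as any [x] below [f].  This is
    Abel summation, done by induction on the prefixes of the order: the gaps
    [D(P) = f P - x(P)] are nonnegative, and each partial sum of
    [y_i (vertex_i - x_i)] over a prefix [P] dominates [c D(P)] for every lower
    bound [c] of [y] on [P]. *)
Lemma greedy f x y : f finset.set0 = 0 ->
    (forall S : {set 'I_n}, vsum x S <= f S) -> (forall j, 0 <= y 0 j) ->
  exists s, dotp x y <= dotp (vertex f s) y.
Proof.
move=> f0 le_xf y_ge0; have [s s_decr] := exists_decreasing_order (y 0).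
exists s; pose d i := vertex f s 0 i - x 0 i.
have d_ge0 m : (m <= n)%N -> 0 <= \sum_(i in prefix s m) d i.
  by move=> le_mn; rewrite sumrB subr_ge0 -!/(vsum _ _) vsum_vertex_prefix.
have abel m c : (m <= n)%N -> (forall i, i \in prefix s m -> c <= y 0 i) ->
    c * \sum_(i in prefix s m) d i <= \sum_(i in prefix s m) d i * y 0 i.
  elim: m c => [|m IHm] c le_mn c_le; first by rewrite prefix0 !big_set0 mulr0.
  pose k := Ordinal le_mn.
  have sk_in : s k \in prefix s m.+1 by rewrite inE permK.
  (* The value of y at the last element is at least c, so c may be raised to
     it; being the smallest one visited, it is still a lower bound on the
     shorter prefix. *)
  apply: le_trans (ler_wpM2r (d_ge0 _ le_mn) (c_le _ sk_in)) _.
  have sumS := sum_prefixS s k; rewrite !sumS /= mulrDr [y 0 (s k) * d _]mulrC lerD2r.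
  apply: IHm (ltnW le_mn) _ => i; rewrite inE => lt_im.
  by apply: s_decr; rewrite permK ltnW.
have := abel n 0 (leqnn n) (fun i _ => y_ge0 i).
rewrite mul0r prefix_size => le0.
rewrite -subr_ge0 /dotp -sumrB (le_trans le0)//.
rewrite le_eqVlt; apply/orP; left; apply/eqP.
by apply: eq_big => i; rewrite ?inE// mulrBl.
Qed.

End Vertices.

(** * Equalizing strategies *)

Section Equalizers.
Variables (R : realType) (n : nat) (f : {set 'I_n} -> R) (w : 'rV[R]_n).
Hypothesis f_set0 : f finset.set0 = 0.
Hypothesis w_gt0 : forall i, 0 < w 0 i.

Lemma winv_gt0 (S : {set 'I_n}) : S != finset.set0 -> 0 < winv w S.
Proof.
case/set0Pn => i iS; rewrite /winv (bigD1 i) //= ltr_wpDr ?invr_gt0//.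
by apply: sumr_ge0 => j _; rewrite invr_ge0 ltW.
Qed.

Lemma ratio_nonincreasing (S T : {set 'I_n}) :
    decreasing_payoff f w -> S != finset.set0 -> S \subset T ->
  f T / winv w T <= f S / winv w S.
Proof.
move=> f_decr S0 ST.
have T0 : T != finset.set0 by apply: contraNneq S0 => T0; rewrite -finset.subset0 -T0.
(* Sorting by this key, which is 2 on S, 1 on T \ S and 0 elsewhere, makes
   both S and T initial segments of the order. *)
have [s s_decr] :=
  exists_decreasing_order (fun i => (i \in S)%:R + (i \in T)%:R : R).
have key_le i j : (s^-1%g j <= s^-1%g i)%N ->
    ((i \in S) + (i \in T) <= (j \in S) + (j \in T))%N.
  by move/s_decr; rewrite -!natrD ler_nat.
have inT i : i \in S -> i \in T := fintype.subsetP ST i.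
have fS : vsum (vertex f s) S = f S.
  apply: vsum_vertex => // i j iS /key_le; rewrite iS (inT _ iS).
  by case: (j \in S) (j \in T) => [] [].
have fT : vsum (vertex f s) T = f T.
  apply: vsum_vertex => // i j iT /key_le; rewrite iT.
  by case: (boolP (j \in S)) => [/inT -> //|_]; case: (i \in S) (j \in T) => [] [].
have sumT F : \sum_(i in T) F i = \sum_(i in S) F i + \sum_(j in T :\: S) F j :> R.
  by rewrite (finset.big_setID S) /= (finset.setIidPr ST).
have cross i j : i \in S -> j \in T :\: S ->
    (w 0 i)^-1 * vertex f s 0 j <= (w 0 j)^-1 * vertex f s 0 i.
  rewrite inE => iS /andP[jS jT].
  have /f_decr : (s^-1%g i < s^-1%g j)%N.
    by rewrite ltnNge; apply/negP => /key_le; rewrite iS (negPf jS) jT (inT _ iS).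
  by rewrite ler_pdivrMl// mulrCA ler_pdivlMl.
have : winv w S * (f T - f S) <= (winv w T - winv w S) * f S.
  rewrite -fS -fT /vsum /winv !sumT ![_ + _ - _]addrAC !subrr !add0r.
  rewrite [leLHS]big_distrlr [leRHS]big_distrlr [leRHS]exchange_big /=.
  by apply: ler_sum => i iS; apply: ler_sum => j jTS; exact: cross.
rewrite mulrBr mulrBl lerD2r => le_cross.
by rewrite ler_pdivrMr ?winv_gt0// mulrAC ler_pdivlMr ?winv_gt0// mulrC
           [leRHS]mulrC.
Qed.

Definition equalizer (v : R) : 'rV[R]_n := \row_i ((w 0 i)^-1 * v).

Lemma payoff_equalizer v i : w 0 i * equalizer v 0 i = v.
Proof. by rewrite mxE mulVKf ?gt_eqF. Qed.

Lemma vsum_equalizer v (S : {set 'I_n}) : vsum (equalizer v) S = winv w S * v.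
Proof. by rewrite /winv mulr_suml; apply: eq_bigr => i _; rewrite mxE. Qed.

Lemma yVE j : yV w 0 j = (winv w [set: 'I_n]%SET)^-1.
Proof.
rewrite !mxE summxE (bigD1 j)//= mxE !eqxx big1 ?addr0 ?mulr1// => i neij.
by rewrite mxE [j == i]eq_sym (negPf neij) andbF.
Qed.

Lemma dotp_yV x :
  dotp x (yV w) = vsum x [set: 'I_n]%SET / winv w [set: 'I_n]%SET.
Proof.
by rewrite /vsum mulr_suml; apply: eq_big => i; rewrite ?inE// yVE.
Qed.

Lemma mixed2E (theta : 'rV[R]_n) j :
  (\sum_i (theta 0 i * w 0 i) *: delta_mx 0 i : 'rV[R]_n) 0 j
  = theta 0 j * w 0 j.
Proof.
rewrite summxE (bigD1 j)//= !mxE !eqxx mulr1 big1 ?addr0// => i neij.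
by rewrite !mxE [j == i]eq_sym (negPf neij) andbF mulr0.
Qed.

Lemma yV_mixed2 : (1 <= n)%N -> mixed2 w (yV w).
Proof.
move=> hn; have W0 : 0 < winv w [set: 'I_n]%SET.
  by apply: winv_gt0; apply/set0Pn; exists (Ordinal hn); rewrite inE.
exists (equalizer (winv w [set: 'I_n]%SET)^-1); split=> [j||].
- by rewrite mxE mulr_ge0 ?invr_ge0 ?ltW.
- have := vsum_equalizer (winv w [set: 'I_n]%SET)^-1 [set: 'I_n]%SET.
  by rewrite mulfV ?gt_eqF// => <-; apply: eq_bigl => i; rewrite inE.
- by apply/rowP => j; rewrite yVE mixed2E mulrC payoff_equalizer.
Qed.

Lemma dotp_equalizer_mixed2 v y : mixed2 w y -> dotp (equalizer v) y = v.
Proof.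
case=> theta [_ theta1 ->].
rewrite -[RHS]mul1r -theta1 mulr_suml; apply: eq_bigr => j _.
by rewrite mixed2E mulrCA [equalizer _ _ _ * _]mulrC payoff_equalizer.
Qed.

Lemma mixed2_ge0 y j : mixed2 w y -> 0 <= y 0 j.
Proof. by case=> theta [t_ge0 _ ->]; rewrite mixed2E mulr_ge0 ?(ltW (w_gt0 _)). Qed.

Lemma guarantee1_equalizer v : (1 <= n)%N -> guarantee1 w (equalizer v) v.
Proof.
move=> hn; split; first by exists (Ordinal hn) => //; rewrite payoff_equalizer.
by move=> _ [j _ <-]; rewrite payoff_equalizer.
Qed.

(** A guarantee [m] bounds each [x_j] below by [m / w_j]; summing over [j] turns
    the bound on the worst coordinate into one on the total. *)
Lemma guarantee1_le x m : guarantee1 w x m ->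
  m * winv w [set: 'I_n]%SET <= vsum x [set: 'I_n]%SET.
Proof.
move=> [_ m_lb]; rewrite mulr_sumr; apply: ler_sum => j _.
by rewrite ler_pdivrMr// mulrC; apply: m_lb; exists j.
Qed.

(** For nonempty [S], the constraint [x(S) <= f S] at the equalizer is the
    inequality between the ratios at [S] and at the whole ground set. *)
Lemma equalizer_in_base :
    (forall S, 0 <= f S) -> (1 <= n)%N -> decreasing_payoff f w ->
  base_polyhedron f (equalizer (f [set: 'I_n]%SET / winv w [set: 'I_n]%SET)).
Proof.
move=> f_ge0 hn f_decr.
have V0 : [set: 'I_n]%SET != finset.set0.
  by apply/set0Pn; exists (Ordinal hn); rewrite inE.
split=> [j|S|].
- by rewrite mxE mulr_ge0 ?divr_ge0 ?invr_ge0 ?(ltW (winv_gt0 V0)) ?(ltW (w_gt0 _)).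
- rewrite vsum_equalizer; have [->|S0] := eqVneq S finset.set0.
    by rewrite /winv big_set0 mul0r f_set0.
  rewrite mulrC -ler_pdivlMr ?winv_gt0//.
  by apply: ratio_nonincreasing => //; exact: finset.subsetT.
- by rewrite vsum_equalizer mulrC divfK ?gt_eqF ?winv_gt0.
Qed.

End Equalizers.

Theorem lemma8 (R : realType) (n : nat) (f : {set 'I_n} -> R) (w : 'rV[R]_n)
  (hn : (1 <= n)%N)
  (f_ge0 : forall S : {set 'I_n}, 0 <= f S)
  (f_nondecr : nondecreasing_setfun f)
  (f_submod : submodular f)
  (f_set0 : f (finset.set0) = 0)
  (w_gt0 : forall i, 0 < w 0 i)
  (f_decr : decreasing_payoff f w) :
  [/\ forall S T : {set 'I_n}, S != finset.set0 -> S \subset T ->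
        f T / winv w T <= f S / winv w S,
      game_value f w (f [set: 'I_n]%SET / winv w [set: 'I_n]%SET),
      optimal1 f w
        (\row_i ((w 0 i)^-1 * (f [set: 'I_n]%SET / winv w [set: 'I_n]%SET))) &
      optimal2 f w (yV w)].
Proof.
have W_gt0 : 0 < winv w [set: 'I_n]%SET.
  by apply: winv_gt0 => //; apply/set0Pn; exists (Ordinal hn); rewrite inE.
set v := f _ / _; rewrite -/(equalizer w v).
have x_base : base_polyhedron f (equalizer w v) by exact: equalizer_in_base.
have x_guar : guarantee1 w (equalizer w v) v by exact: guarantee1_equalizer.
have y_mixed : mixed2 w (yV w) by exact: yV_mixed2.
have vertex_yV s : dotp (vertex f s) (yV w) = v.
  by rewrite dotp_yV vsum_vertex// => i j; rewrite !inE.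
have base_yV x : base_polyhedron f x -> dotp x (yV w) = v.
  by case=> _ _ xV; rewrite dotp_yV xV.
have value : game_value f w v.
  split; split.
  - by exists (equalizer w v).
  - move=> m [x [_ _ xV] /(guarantee1_le w_gt0)].
    by rewrite xV -ler_pdivlMr.
  - exists (yV w) => //; split; first by exists 1%g.
    by move=> _ [s _ <-]; rewrite vertex_yV.
  - move=> m [y y_mix [_ m_ub]].
    rewrite -(dotp_equalizer_mixed2 w_gt0 v y_mix).
    have [_ x_le _] := x_base.
    have [s le_s] := greedy f_set0 x_le (fun j => mixed2_ge0 w_gt0 j y_mix).
    by apply: le_trans le_s _; apply: m_ub; exists s.
split=> //.
- by move=> S T; exact: ratio_nonincreasing.
- by split=> //; exists v.
- split=> //; exists v => //; split; first by exists (equalizer w v); rewrite ?base_yV.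
  by move=> _ [x /base_yV + <-] => ->.
Qed.
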